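(* Let $f:X\to\mathbb{R}$ be a Walters's summable potential with associated sequences and limits $a_n\to a$, $b_n\to b$, $c_n\to c$, $d_n\to d$. Suppose $a=c=\beta(f)$ and that every $f$-maximizing measure is of the form $s\,\delta_{0^\infty}+(1-s)\,\delta_{1^\infty}$ with $s\in[0,1]$. Then there exists a unique real value $A\le 0$ such that $$2\beta(f)=\max\Big\{\sup_{j\ge 0}(d_{1+j}+a_2+\dots+a_{1+j}-j\beta(f)),\ d+\sum_{j=1}^\infty(a_{1+j}-\beta(f))-A\Big\}$$ $$\qquad+\max\Big\{\sup_{j\ge 0}(b_{1+j}+c_2+\dots+c_{1+j}-j\beta(f)),\ b+\sum_{j=1}^\infty(c_{1+j}-\beta(f))-A\Big\}.$$ Moreover the limit $V:=\lim_{t\to\infty}\frac1t\log(h_t)$ exists (pointwise on $X$), and for all $q\ge 1$ and $z\in X$ it satisfies $$V(0^\infty)=0,$$ $$V(1^\infty)=b-d-\beta(f)+\max\Big\{\sup_{j\ge0}(d_{1+j}+a_2+\dots+a_{1+j}-j\beta(f)),\ d+\sum_{j=1}^\infty(a_{1+j}-\beta(f))-A\Big\},$$ $$V(0^q1z)=A-d+\max\Big\{\sup_{j\ge0}(d_{q+j}+a_{q+1}+\dots+a_{q+j}-j\beta(f)),\ d+\sum_{j=1}^\infty(a_{q+j}-\beta(f))-A\Big\},$$ $$V(1^q0z)=-d-\beta(f)+A+\max\Big\{\sup_{j\ge0}(d_{1+j}+a_2+\dots+a_{1+j}-j\beta(f)),\ d+\sum_{j=1}^\infty(a_{1+j}-\beta(f))-A\Big\}$$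 $$\qquad+\max\Big\{\sup_{j\ge0}(b_{q+j}+c_{q+1}+\dots+c_{q+j}-j\beta(f)),\ b+\sum_{j=1}^\infty(c_{q+j}-\beta(f))-A\Big\}.$$
   Context: $X=\{0,1\}^{\mathbb N}$ with the product topology, $\sigma$ is the left shift on $X$, $\mathcal M$ is the set of $\sigma$-invariant Borel probability measures on $X$. For $n\ge1$, $0^n$ and $1^n$ are the words of $n$ consecutive $0$'s, respectively $1$'s; $0^\infty,1^\infty$ are the constant sequences. The class $R(X)$: $f:X\to\mathbb R$ is in $R(X)$ if there are real sequences $(a_n)_{n\ge2}\to a$, $(b_n)_{n\ge1}\to b$, $(c_n)_{n\ge2}\to c$, $(d_n)_{n\ge1}\to d$ such that for all $z\in X$, $p\ge2$, $q\ge1$: $f(0^p1z)=a_p$, $f(01^q0z)=b_q$, $f(1^p0z)=c_p$, $f(10^q1z)=d_q$, and $f(0^\infty)=a$, $f(01^\infty)=b$, $f(1^\infty)=c$, $f(10^\infty)=d$. A Walters's summable potential is $f\in R(X)$ such that the series $\sum_{n\ge2}(a_n-a)$ and $\sum_{n\ge2}(c_n-c)$ converge. $\beta(f)=\sup_{\rho\in\mathcal M}\int f\,d\rho$; a measure in $\mathcal M$ attaining this supremum is called maximizing for $f$. For $t>0$ the Ruelle operator on continuous functions is $L_{tf}(w)(x)=\sum_{\sigma(y)=x}e^{tf(y)}w(y)$, and $P(tf)=\sup_{\rho\in\mathcal M}\big(h(\rho)+t\int f\,d\rho\big)$, where $h(\rho)$ is the Kolmogorov entropy. It is known (Walters) that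 there is a strictly positive continuous function $h_t$ on $X$ with $L_{tf}h_t=e^{P(tf)}h_t$; it is normalized by $h_t(0^\infty)=1$. Convention: for fixed $q\ge1$ and $j=0$, an expression such as $a_{q+1}+\dots+a_{q+j}$ (or $c_{q+1}+\dots+c_{q+j}$) equals $0$. *)

(* Defs.v *)
From HB Require Import structures.
From mathcomp Require Import all_boot all_order all_algebra.
From mathcomp Require Import all_classical all_reals all_analysis.
Set Implicit Arguments.
Unset Strict Implicit.
Unset Printing Implicit Defensive.
Import Order.TTheory GRing.Theory Num.Theory.
Import numFieldNormedType.Exports.
Local Open Scope classical_set_scope.
Local Open Scope ring_scope.

(* X = {0,1}^N, with false for the symbol 0 and true for 1. *)
Notation fullshift := cantor_space.

(* fullshift with its Borel sigma-algebra; the two carriers are convertible. *)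
Notation borel_fullshift := (g_sigma_algebraType (@open fullshift)).

Definition shiftmap (x : fullshift) : fullshift := fun i => x i.+1.

Definition prepend (w : seq bool) (z : fullshift) : fullshift :=
  fun i => if (i < size w)%N then nth false w i else z (i - size w)%N.

Definition zeros : fullshift := fun=> false.
Definition ones : fullshift := fun=> true.

Section Potentials.
Context {R : realType}.
Implicit Types (f : fullshift -> R) (a b c d t : R).

(* f belongs to R(X) with the given associated sequences and limits.  Only
   a_ n, c_ n for n >= 2 and b_ n, d_ n for n >= 1 are meaningful. *)
Record walters_class f (a_ b_ c_ d_ : nat -> R) a b c d : Prop := {
  walters_cvga : a_ @ \oo --> a;
  walters_cvgb : b_ @ \oo --> b;
  walters_cvgc : c_ @ \oo --> c;
  walters_cvgd : d_ @ \oo --> d;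
  walters_a : forall p (z : fullshift), (2 <= p)%N ->
    f (prepend (nseq p false ++ [:: true]) z) = a_ p;
  walters_b : forall q (z : fullshift), (1 <= q)%N ->
    f (prepend ([:: false] ++ nseq q true ++ [:: false]) z) = b_ q;
  walters_c : forall p (z : fullshift), (2 <= p)%N ->
    f (prepend (nseq p true ++ [:: false]) z) = c_ p;
  walters_d : forall q (z : fullshift), (1 <= q)%N ->
    f (prepend ([:: true] ++ nseq q false ++ [:: true]) z) = d_ q;
  walters_zeros : f zeros = a;
  walters_0ones : f (prepend [:: false] ones) = b;
  walters_ones : f ones = c;
  walters_1zeros : f (prepend [:: true] zeros) = d }.

Record walters_summable f (a_ b_ c_ d_ : nat -> R) a b c d : Prop := {
  walters_summable_class : walters_class f a_ b_ c_ d_ a b c d;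
  walters_summable_a : cvgn (fun N => \sum_(2 <= n < N) (a_ n - a));
  walters_summable_c : cvgn (fun N => \sum_(2 <= n < N) (c_ n - c)) }.

Definition invariant_measures : set (probability borel_fullshift R) :=
  [set rho : probability borel_fullshift R |
     forall A : set borel_fullshift, measurable A ->
     rho (shiftmap @^-1` A) = rho A].

(* Junk-free as a real supremum: f in R(X) is continuous, hence bounded. *)
Definition beta f : R :=
  sup [set \int[rho]_x f x | rho in invariant_measures].

Definition maximizing f (rho : probability borel_fullshift R) : Prop :=
  invariant_measures rho /\ \int[rho]_x f x = beta f.

Definition measurable_partition k (xi : 'I_k -> set borel_fullshift) : Prop :=
  [/\ forall i, measurable (xi i),
      trivIset setT xi
    & \bigcup_(i in [set: 'I_k]) xi i = setT].

(* The atom of the join of xi, sigma^-1 xi, ..., sigma^-(n-1) xi labelled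
   by w; an empty atom contributes 0 to the entropy. *)
Definition join_atom k (xi : 'I_k -> set borel_fullshift) n
    (w : {ffun 'I_n -> 'I_k}) : set borel_fullshift :=
  \bigcap_(i in [set: 'I_n]) (iter i shiftmap @^-1` xi (w i)).

Definition join_entropy (rho : probability borel_fullshift R) k
    (xi : 'I_k -> set borel_fullshift) (n : nat) : R :=
  - \sum_(w : {ffun 'I_n -> 'I_k})
      fine (rho (join_atom xi w)) * ln (fine (rho (join_atom xi w))).

Definition partition_entropy (rho : probability borel_fullshift R) k
    (xi : 'I_k -> set borel_fullshift) : R :=
  limn (fun n => join_entropy rho xi n / n%:R).

Definition entropy (rho : probability borel_fullshift R) : \bar R :=
  ereal_sup [set e | exists k (xi : 'I_k -> set borel_fullshift),
    measurable_partition xi /\ e = (partition_entropy rho xi)%:E].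

Definition pressure t f : \bar R :=
  ereal_sup [set (entropy rho + (t * \int[rho]_x f x)%:E)%E
            | rho in invariant_measures].

Definition ruelle t f (w : fullshift -> R) (x : fullshift) : R :=
  \sum_(y \in [set y : fullshift | shiftmap y = x]) expR (t * f y) * w y.

Definition normalized_eigenfunction t f (h : fullshift -> R) : Prop :=
  [/\ continuous h,
      forall x, 0 < h x,
      forall x, ruelle t f h x = expR (fine (pressure t f)) * h x
    & h zeros = 1].

(* max { sup_(j >= 0) (u_(q+j) + v_(q+1) + ... + v_(q+j) - j * be),
         u + sum_(j >= 1) (v_(q+j) - be) - A }
   Used only with v_ -> be and sum (v_n - be) convergent, so that the set in
   the supremum is bounded and the limit exists. *)
Definition max_term (u_ : nat -> R) (u : R) (v_ : nat -> R) (be A : R)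
    (q : nat) : R :=
  Num.max
    (sup [set u_ (q + j)%N + \sum_(1 <= i < j.+1) v_ (q + i)%N - j%:R * be
         | j in [set: nat]])
    (u + limn (fun N => \sum_(1 <= j < N) (v_ (q + j)%N - be)) - A).

End Potentials.

(* Main.v *)
(* Solve the eigenvalue equation L h = lam * h explicitly.  Since [f] only reads
   the first maximal blocks, [h] is constant on each cylinder of words s^q (~s),
   and the equation becomes a linear recursion in q.  With r = e^(t beta) / lam < 1
   it unfolds to lam h(s^q ~s) / h(~s s) = sum_j e^(t w_j) r^j, where w_j is the
   jth expression in the supremum of [max_term] and converges to a limit w.
   At exponential scale this sum is max(sup_j w_j, w - A_t), the second entry
   coming from the geometric tail, with A_t = ln(1/r - 1) / t.
   Multiplying the identities for s = 0 and s = 1 at q = 1 gives lam^2, so A_t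
   approximately solves the equation defining A.  The periodic orbits of
   0^(j+1) 1^(k+1) are not maximizing, so two attained suprema add up to less
   than 2 beta; this forces r >= 1/2 (whence A_t <= 0 and ln lam / t -> beta) and
   the uniqueness of A, and A_t -> A follows by monotonicity. *)
Require Import Defs.
From HB Require Import structures.
From mathcomp Require Import all_boot all_order all_algebra.
From mathcomp Require Import all_classical all_reals all_analysis.
From mathcomp Require Import measurable_realfun ring lra.
From mathcomp Require Import zify.
Set Implicit Arguments.
Unset Strict Implicit.
Unset Printing Implicit Defensive.
Import Order.TTheory GRing.Theory Num.Theory.
Import numFieldNormedType.Exports.
Local Open Scope classical_set_scope.
Local Open Scope ring_scope.

(** * Words, cylinders and the class R(X) *)

Lemma nbhs_cylinder (x : fullshift) n :
  nbhs x [set y : fullshift | forall i, (i < n)%N -> y i = x i].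
Proof.
elim: n => [|n IH]; first by apply: filterS filterT.
have cx : nbhs x [set y : fullshift | y n = x n].
  have := @proj_continuous nat (fun=> bool) n x [set b | b = x n].
  apply; exact: discrete_set1.
apply: filterS (filterI IH cx) => y /= [H1 H2] i.
by rewrite ltnS leq_eqVlt => /orP[/eqP->//|]; exact: H1.
Qed.

(** The filter generated by the cylinders at [x] converges to [x] in every coordinate, hence in the
    product topology, so every neighbourhood contains a cylinder. *)
Lemma nbhs_cylinderP (x : fullshift) (U : set fullshift) : nbhs x U ->
  exists n, forall y : fullshift, (forall i, (i < n)%N -> y i = x i) -> U y.
Proof.
pose C n := [set y : fullshift | forall i, (i < n)%N -> y i = x i].
pose G := filter_from [set: nat] C.
have FG : ProperFilter G.
  apply: filter_from_proper; last by move=> n _; exists x.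
  apply: filter_from_filter; first by exists 0%N.
  move=> i j _ _; exists (maxn i j) => // y Cy.
  by split=> k ki; apply: Cy; rewrite leq_max ki ?orbT.
suff cG : G --> x by move=> /cG[n _ CU]; exists n.
apply/cvg_sup => i; apply/cvg_image.
  rewrite eqEsubset; split=> // b _; exists (fun=> b) => //.
move=> W nW; exists ((@^~ i) @^-1` W).
  exists i.+1 => // y Cy /=; rewrite Cy//.
  exact: (nbhs_singleton nW).
by rewrite image_preimage// eqEsubset; split=> // b _; exists (fun=> b).
Qed.

Lemma nbhs_cylinderE (x : fullshift) (U : set fullshift) : nbhs x U <->
  exists n, forall y : fullshift, (forall i, (i < n)%N -> y i = x i) -> U y.
Proof.
split=> [|[n nU]]; first exact: nbhs_cylinderP.
by apply: filterS (nbhs_cylinder x n).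
Qed.

Definition scons (s : bool) (x : fullshift) : fullshift :=
  fun i => if i is j.+1 then x j else s.

(** At [false] and [true] this is convertible with the points 0^q 1 z and 1^q 0 z of the theorem, so
    both symbols can be treated at once. *)
Definition block (s : bool) (q : nat) (z : fullshift) : fullshift :=
  prepend (nseq q s ++ [:: ~~ s]) z.

Definition const_seq (s : bool) : fullshift := fun=> s.

Lemma scons_shiftmap (x : fullshift) : scons (x 0%N) (shiftmap x) = x.
Proof. by apply/funext => -[]. Qed.

Lemma prepend_nil z : prepend [::] z = z.
Proof. by apply/funext => i; rewrite /prepend subn0. Qed.

Lemma prepend_cons s w z : prepend (s :: w) z = scons s (prepend w z).
Proof. by apply/funext => -[|i]//; rewrite /prepend /= ltnS subSS. Qed.

Lemma prepend_cat u w z : prepend (u ++ w) z = prepend u (prepend w z).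
Proof.
by elim: u => [|s u IH] /=; rewrite ?prepend_nil// !prepend_cons IH.
Qed.

Lemma prepend_prefix (w : seq bool) (y : fullshift) :
  (forall i, (i < size w)%N -> y i = nth false w i) ->
  y = prepend w (fun i => y (i + size w)%N).
Proof.
move=> yw; apply/funext => i; rewrite /prepend; case: ltnP => [/yw//|wi].
by rewrite subnK.
Qed.

Lemma block_cons s q z : block s q.+1 z = scons s (block s q z).
Proof. by rewrite /block /= prepend_cons. Qed.

Lemma block0 s z : block s 0 z = scons (~~ s) z.
Proof. by rewrite /block /= prepend_cons prepend_nil. Qed.

Lemma block_prepend s q z : block s q z = prepend (nseq q s) (scons (~~ s) z).
Proof. by rewrite /block prepend_cat prepend_cons prepend_nil. Qed.

Lemma block1 s z : block (~~ s) 1 z = scons (~~ s) (scons s z).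
Proof. by rewrite block_cons block0 negbK. Qed.

Lemma const_seq_cons s : scons s (const_seq s) = const_seq s.
Proof. by apply/funext => -[]. Qed.

Lemma block_constE s q z i : (i < q)%N -> block s q z i = s.
Proof.
move=> iq; rewrite /block /prepend size_cat size_nseq ifT; last lia.
by rewrite nth_cat size_nseq iq nth_nseq iq.
Qed.

(** The exponent [p] is the least index at which [y] differs from [s], if there is one. *)
Lemma const_cylinder s n (y : fullshift) : (forall i, (i < n)%N -> y i = s) ->
  y = const_seq s \/ exists p z, (n <= p)%N /\ y = block s p z.
Proof.
move=> yn.
have [/asboolP ex|/asboolP nex] := boolP `[< exists m, y m != s >]; last first.
  left; apply/funext => i; apply/eqP/negPn/negP => yi.
  by apply: nex; exists i.
right; case: (ex_minnP ex) => m ym mmin; exists m, (fun i => y (i + m.+1)%N).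
split; first by rewrite leqNgt; apply: contra_neqN ym => /yn.
have sz : size (nseq m s ++ [:: ~~ s]) = m.+1.
  by rewrite size_cat size_nseq addn1.
rewrite /block -sz; apply: prepend_prefix => i; rewrite sz ltnS => im.
rewrite nth_cat size_nseq nth_nseq; case: ltnP => mi.
  by apply/eqP/negPn/negP => /mmin; rewrite leqNgt mi.
have -> : i = m by apply/eqP; rewrite eqn_leq im mi.
by rewrite subnn /=; case: (y m) (s) ym => -[].
Qed.

Lemma block_cylinder s q z (y : fullshift) :
  (forall i, (i < q.+1)%N -> y i = block s q z i) -> exists z', y = block s q z'.
Proof.
move=> yq; exists (fun i => y (i + size (nseq q s ++ [:: ~~ s]))%N).
apply: prepend_prefix => i; rewrite size_cat size_nseq addn1 => iq.
by rewrite yq// /block /prepend size_cat size_nseq addn1 iq.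
Qed.

Lemma fullshift_cases (x : fullshift) :
  (exists s, x = const_seq s) \/ exists s q z, (1 <= q)%N /\ x = block s q z.
Proof.
have [|->|[p [z [p1 ->]]]] := @const_cylinder (x 0%N) 1 x.
- by case.
- by left; exists (x 0%N).
- by right; exists (x 0%N), p, z.
Qed.

Lemma mem_word_split (s : bool) (w : seq bool) : s \in w ->
  exists k w', w = nseq k (~~ s) ++ s :: w'.
Proof.
elim: w => [//|r w IH]; rewrite inE; case: (eqVneq s r) => [<- _|sr /=].
  by exists 0%N, w.
move=> /IH[k [w' ->]]; exists k.+1, w' => /=; congr (_ :: _).
by move: sr; case: (s); case: (r).
Qed.

Section Walters.
Context {R : realType}.

Lemma continuous_fullshiftP (g : fullshift -> R) (x : fullshift) :
  {for x, continuous g} <-> forall e, 0 < e -> exists n, forall y : fullshift,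
    (forall i, (i < n)%N -> y i = x i) -> `|g x - g y| < e.
Proof.
split=> [/cvgrPdist_lt cg e /cg /nbhs_cylinderP//|cg].
by apply/cvgrPdist_lt => e /cg ?; exact/nbhs_cylinderE.
Qed.

(* Indexing by the repeated symbol exposes the 0/1 symmetry: [va] is ([a_], [c_])
   and [vb] is ([b_], [d_]) at ([false], [true]). *)
Record walters_sym (f : fullshift -> R) (va vb : bool -> nat -> R)
    (la lb : bool -> R) : Prop := {
  wcvga : forall s, va s @ \oo --> la s;
  wcvgb : forall s, vb s @ \oo --> lb s;
  wva : forall s p z, (2 <= p)%N -> f (block s p z) = va s p;
  wvb : forall s q z, (1 <= q)%N -> f (scons s (block (~~ s) q z)) = vb s q;
  wla : forall s, f (const_seq s) = la s;
  wlb : forall s, f (scons s (const_seq (~~ s))) = lb s }.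

Arguments wcvga {f va vb la lb} _ s : rename.
Arguments wcvgb {f va vb la lb} _ s : rename.

Lemma walters_class_sym f (a_ b_ c_ d_ : nat -> R) a b c d :
  walters_class f a_ b_ c_ d_ a b c d ->
  walters_sym f (fun s => if s then c_ else a_) (fun s => if s then d_ else b_)
    (fun s => if s then c else a) (fun s => if s then d else b).
Proof.
move=> hf; split=> [[]|[]|[] p z p2|[] q z q1|[]|[]] /=.
- exact: walters_cvgc hf.
- exact: walters_cvga hf.
- exact: walters_cvgd hf.
- exact: walters_cvgb hf.
- exact: walters_c hf _ _ p2.
- exact: walters_a hf _ _ p2.
- by rewrite -prepend_cons; exact: walters_d hf _ _ q1.
- by rewrite -prepend_cons; exact: walters_b hf _ _ q1.
- exact: walters_ones hf.
- exact: walters_zeros hf.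
- by rewrite -(walters_1zeros hf) prepend_cons prepend_nil.
- by rewrite -(walters_0ones hf) prepend_cons prepend_nil.
Qed.

Section Sym.
Context {f : fullshift -> R} {va vb : bool -> nat -> R} {la lb : bool -> R}.
Hypothesis hf : walters_sym f va vb la lb.

(** When the blocks read by [f] are finite, [f] is locally constant. At s^oo and s (~s)^oo
    continuity is the convergence of [va] and [vb]. *)
Lemma walters_continuous : continuous f.
Proof.
move=> x; apply/continuous_fullshiftP => e e0.
case: (fullshift_cases x) => [[s ->]|[s [[|[|q]] [z [// _ ->]]]]].
- have /cvgrPdist_lt/(_ _ e0)[N _ HN] := wcvga hf s.
  exists (maxn N 2) => y /const_cylinder[->|[p [z [Np ->]]]].
    by rewrite subrr normr0.
  by rewrite (wla hf) (wva hf); [apply: HN; rewrite /=|]; lia.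
- rewrite block_cons block0.
  case: (fullshift_cases (scons (~~ s) z)) => [[r]|[r [q [z' [q1]]]]] sz.
    have rs : ~~ s = r by have /(congr1 (fun x => x 0%N)) := sz.
    rewrite sz -rs; move: sz => _.
    have /cvgrPdist_lt/(_ _ e0)[N _ HN] := wcvgb hf s.
    exists N.+2 => y Hy; rewrite -(scons_shiftmap y) (Hy 0%N)//=.
    have /(const_cylinder (n := N.+1)) : forall i, (i < N.+1)%N -> shiftmap y i = ~~ s.
      by move=> i iN; rewrite /shiftmap Hy.
    move=> [->|[p [z'' [Np ->]]]]; first by rewrite subrr normr0.
    by rewrite (wlb hf) (wvb hf)//; [apply: HN; rewrite /=|]; lia.
  have rs : ~~ s = r.
    by have /(congr1 (fun x => x 0%N)) := sz; rewrite block_constE.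
  rewrite sz -rs; move: sz => _.
  exists q.+2 => y Hy; rewrite -(scons_shiftmap y) (Hy 0%N)//=.
  have /block_cylinder[z'' ->] : forall i, (i < q.+1)%N ->
      shiftmap y i = block (~~ s) q z' i.
    by move=> i iq; rewrite /shiftmap Hy.
  by rewrite !(wvb hf)// subrr normr0.
- exists q.+3 => y /block_cylinder[z' ->].
  by rewrite !(wva hf)// subrr normr0.
Qed.

(** If [w] starts with [r], then [f] reads only the first block, which ends at the first [~~ r] of
    [w]. Otherwise it reads the second block, which ends at the first [r] of [w]. In both cases [z]
    is never reached. *)
Lemma walters_word (r : bool) (w : seq bool) z z' : (forall s, s \in w) ->
  f (prepend (r :: w) z) = f (prepend (r :: w) z').
Proof.
have blockE s k w1 y : prepend (nseq k s ++ ~~ s :: w1) y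
    = block s k (prepend w1 y) by rewrite /block -prepend_cat -catA.
move=> hw; have [[|k] [w' wE]] := mem_word_split (hw (~~ r)); last first.
  by rewrite wE negbK -[r :: _]/(nseq k.+2 r ++ ~~ r :: w') !blockE !(wva hf).
have [[|k] [w'' wE']] := mem_word_split (hw r).
  by move: wE; rewrite wE' /=; case: (r).
have fE y : f (prepend (r :: w) y) = vb r k.+1.
  have := blockE (~~ r) k.+1 w'' y; rewrite negbK => bE.
  by rewrite wE' prepend_cons bE (wvb hf).
by rewrite !fE.
Qed.

End Sym.
End Walters.

(** * The eigenfunction equation *)

Section Compactness.
Context {R : realType}.
Implicit Types g : fullshift -> R.

Lemma fullshift_uniformly_continuous g : continuous g -> forall e, 0 < e ->
  exists n, forall x y : fullshift, (forall i, (i < n)%N -> y i = x i) ->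
    `|g x - g y| < e.
Proof.
move=> cg e e0.
have /compact_near_coveringP/(_ nat \oo (fun n x => forall y : fullshift,
  (forall i, (i < n)%N -> y i = x i) -> `|g x - g y| < e)) := cantor_space_compact.
case=> [x _|n _ Hn]; last first.
  by exists n => x; exact: (Hn n (leqnn n) x I).
have [n Hn] := (continuous_fullshiftP g x).1 (cg x) _ (divr_gt0 e0 (ltr0Sn _ 1)).
exists ([set y : fullshift | forall i, (i < n)%N -> y i = x i],
        [set m | (n <= m)%N]) => /=.
  by split; [exact: nbhs_cylinder|exact: nbhs_infty_ge].
move=> [x' m] /= [xx' nm] y yx'.
have -> : g x' - g y = (g x - g y) - (g x - g x') by ring.
rewrite (le_lt_trans (ler_normB _ _))// (splitr e) ltrD// Hn// => i iN.
by rewrite yx' ?xx'//; exact: leq_trans nm.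
Qed.

Lemma fullshift_bounded g : continuous g -> exists M, forall x, `|g x| <= M.
Proof.
move=> cg; have /compact_bounded[M [_ HM]] :=
  continuous_compact (continuous_subspaceT cg) cantor_space_compact.
exists (M + 1) => x; apply: (HM (M + 1)); first by rewrite ltrDl.
by exists x.
Qed.
End Compactness.

Section Eigenfunction.
Context {R : realType} {f : fullshift -> R} {va vb : bool -> nat -> R}
  {la lb : bool -> R}.
Hypothesis hf : walters_sym f va vb la lb.

Lemma ruelleE t (h : fullshift -> R) x s : ruelle t f h x =
  expR (t * f (scons s x)) * h (scons s x)
  + expR (t * f (scons (~~ s) x)) * h (scons (~~ s) x).
Proof.
rewrite /ruelle.
have -> : [set y | shiftmap y = x]
    = [set scons s x] `|` [set scons (~~ s) x].
  rewrite eqEsubset; split=> [y /= yx|y /= [->|->]//].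
  rewrite -(scons_shiftmap y) yx; case: (y 0%N) (s) => -[]; by [left|right].
rewrite fsbigU0 ?fsbig_set1//; try exact: finite_set1.
move=> y [-> /(congr1 (fun y => y 0%N))] /=.
by case: s.
Qed.

Variables (t lam : R) (h : fullshift -> R).
Hypotheses (hc : continuous h) (h_gt0 : forall x, 0 < h x)
  (h_eig : forall x, ruelle t f h x = lam * h x).

Lemma eigenvalue_gt0 : 0 < lam.
Proof.
rewrite -(pmulr_lgt0 _ (h_gt0 zeros)) -h_eig (ruelleE _ _ _ true).
by rewrite addr_gt0// mulr_gt0// expR_gt0.
Qed.

(** The eigenvalue equation is iterated until the added prefix [u] has length [n], where uniform
    continuity of [ln h] bounds the ratio of the two values by [expR e]. The weights met on the way
    agree for [z] and [z'] by [walters_word], so the bound descends to the empty prefix, and [e] is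
    arbitrary. *)
Lemma eigenfunction_word_le (w : seq bool) z z' : (forall s, s \in w) ->
  h (prepend w z) <= h (prepend w z').
Proof.
move=> hw; rewrite -ler_ln ?posrE//; apply/ler_addgt0Pl => e e0.
have lc : continuous (fun x => ln (h x)).
  by move=> x; apply: continuous_comp; [exact: hc|exact: continuous_ln].
have [n Hn] := fullshift_uniformly_continuous lc e0.
(* [k] counts the letters that [u] lacks to reach length [n]. *)
suff main k u : (size u + k = n)%N ->
    h (prepend (u ++ w) z) <= expR e * h (prepend (u ++ w) z').
  have := main n [::] erefl; rewrite -ler_ln ?posrE ?mulr_gt0 ?expR_gt0//.
  by rewrite lnM ?posrE ?expR_gt0// expRK.
elim: k u => [|k IH] u un.
  rewrite -ler_ln ?posrE ?mulr_gt0 ?expR_gt0// lnM ?posrE ?expR_gt0// expRK.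
  rewrite -lerBlDr (le_trans (ler_norm _))// ltW// Hn// => i; rewrite addn0 in un.
  by rewrite -un => iu; rewrite !prepend_cat /prepend iu.
rewrite -(ler_pM2l eigenvalue_gt0) mulrCA -!h_eig !(ruelleE _ _ _ true) mulrDr.
have step s : expR (t * f (scons s (prepend (u ++ w) z))) *
      h (scons s (prepend (u ++ w) z)) <=
    expR e * (expR (t * f (scons s (prepend (u ++ w) z'))) *
      h (scons s (prepend (u ++ w) z'))).
  rewrite -!prepend_cons (walters_word hf _ _ z').
    by rewrite mulrCA ler_wpM2l ?expR_ge0//; apply: (IH (s :: u)); rewrite /= addSnnS.
  by move=> r; rewrite mem_cat hw orbT.
by rewrite lerD.
Qed.

Lemma eigenfunction_block s q z z' : (1 <= q)%N ->
  h (block s q z) = h (block s q z').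
Proof.
move=> q1; have hw r : r \in nseq q s ++ [:: ~~ s].
  by rewrite mem_cat mem_nseq q1 inE; case: (r) (s) => -[].
by apply/le_anti; rewrite !eigenfunction_word_le.
Qed.

(** One preimage lengthens the block. The other lies in the cylinder of (~s) s, where [h] is
    constant, so its value does not depend on [q]. *)
Lemma eigen_recursion s q : (1 <= q)%N ->
  lam * h (block s q zeros) = expR (t * va s q.+1) * h (block s q.+1 zeros)
  + expR (t * vb (~~ s) q) * h (block (~~ s) 1 zeros).
Proof.
move=> q1; rewrite -h_eig (ruelleE _ _ _ s) -block_cons (wva hf)//.
congr (_ + _ * _); first by rewrite -{2}(negbK s) (wvb hf).
rewrite -[q in LHS]prednK// block_cons -block1.
exact: eigenfunction_block.
Qed.

Lemma eigen_const s :
  lam * h (const_seq s) = expR (t * la s) * h (const_seq s)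
  + expR (t * lb (~~ s)) * h (block (~~ s) 1 zeros).
Proof.
rewrite -h_eig (ruelleE _ _ _ s) const_seq_cons (wla hf).
congr (_ + _ * _); first by rewrite -{2}(negbK s) (wlb hf).
by rewrite -const_seq_cons -block1; exact: eigenfunction_block.
Qed.

Lemma eigenfunction_block_cvg s : h (block s n zeros) @[n --> \oo] --> h (const_seq s).
Proof.
apply/cvgrPdist_lt => e e0.
have [n Hn] := (continuous_fullshiftP h (const_seq s)).1 (@hc _) _ e0.
exists n => // m /= nm; apply: Hn => i iN.
by rewrite block_constE// (leq_trans iN).
Qed.

End Eigenfunction.

(** * Measures on periodic orbits *)

Section OrbitMeasure.
Context {R : realType}.

Lemma continuous_borel_measurable (g : fullshift -> R) : continuous g ->
  measurable_fun setT (g : borel_fullshift -> R).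
Proof.
move=> /continuousP cg; apply: (measurability _ (RGenOpens.measurableE R)).
move=> _ [_ [a [b ->] <-]]; rewrite setTI; apply: sub_sigma_algebra.
exact/cg/interval_open.
Qed.

Definition orbit_measure (x : fullshift) (n : nat) : set borel_fullshift -> \bar R :=
  mscale (n.+1%:R^-1)%:nng
    (msum (fun i => \d_(iter i shiftmap x : borel_fullshift)) n.+1).

HB.instance Definition _ x n := Measure.on (orbit_measure x n).

Lemma orbit_measureE x n A : orbit_measure x n A =
  (n.+1%:R^-1 * \sum_(i < n.+1) \1_A (iter i shiftmap x : borel_fullshift))%:E.
Proof.
rewrite /orbit_measure /mscale /msum /= EFinM -sumEFin.
by congr (_ * _)%E; apply: eq_bigr => i _; rewrite diracE.
Qed.

Let orbit_measure_setT x n : orbit_measure x n setT = 1%E.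
Proof.
rewrite orbit_measureE (eq_bigr (fun=> 1)) => [|i _]; last by rewrite indicT.
by rewrite sumr_const card_ord mulVf.
Qed.

HB.instance Definition _ x n :=
  Measure_isProbability.Build _ _ _ (orbit_measure x n) (orbit_measure_setT x n).

Lemma orbit_measure_invariant x n : iter n.+1 shiftmap x = x ->
  invariant_measures (orbit_measure x n).
Proof.
move=> px A _.
change (orbit_measure x n (shiftmap @^-1` A) = orbit_measure x n A).
rewrite !orbit_measureE; congr (_ * _)%:E.
rewrite big_ord_recr big_ord_recl addrC; congr (_ + _).
by rewrite -[x in RHS]px.
Qed.

(** Linearity in the measure is applied to nonnegative integrands, then to the positive and negative
    parts of [g]. *)
Lemma integral_orbit_measure x n (g : fullshift -> R) : continuous g ->
  \int[orbit_measure x n]_y g y = n.+1%:R^-1 * \sum_(i < n.+1) g (iter i shiftmap x).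
Proof.
move=> /continuous_borel_measurable mg.
have mEg : measurable_fun [set: borel_fullshift] (EFin \o g).
  exact/measurable_EFinP.
have ge0E (u : borel_fullshift -> R) :
    measurable_fun [set: borel_fullshift] (EFin \o u) ->
    (forall y, 0 <= u y) ->
    (\int[orbit_measure x n]_y (u y)%:E =
      (n.+1%:R^-1 * \sum_(i < n.+1) u (iter i shiftmap x))%:E)%E.
  move=> mu u0.
  rewrite ge0_integral_mscale//; last by move=> y _; rewrite lee_fin.
  rewrite ge0_integral_measure_sum//; last by move=> y _; rewrite lee_fin.
  rewrite EFinM -sumEFin; congr (_ * _)%E; apply: eq_bigr => i _.
  by rewrite integral_dirac// diracT mul1e.
have posE : (EFin \o g)^\+%E = EFin \o (fun y => Num.max (g y) 0).
  by apply/funext => y; rewrite funeposE /= EFin_max.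
have negE : (EFin \o g)^\-%E = EFin \o (fun y => Num.max (- g y) 0).
  by apply/funext => y; rewrite funenegE /= EFin_max.
rewrite /Rintegral integralE posE negE !ge0E; last first.
- by move=> y; rewrite le_max lexx orbT.
- by rewrite -posE; exact: measurable_funepos.
- by move=> y; rewrite le_max lexx orbT.
- by rewrite -negE; exact: measurable_funeneg.
rewrite -EFinB /= -mulrBr -sumrB; congr (_ * _); apply: eq_bigr => i _.
set v := g _; have [v0|v0] := orP (le_total 0 v).
  by rewrite max_l// max_r ?subr0// oppr_le0.
by rewrite max_r// max_l ?sub0r ?opprK// oppr_ge0.
Qed.

Section Beta.
Context {f : fullshift -> R}.
Hypothesis fc : continuous f.

(** This makes [beta f] a genuine upper bound: a real [sup] dominates its set only when that set is
    bounded above. *)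
Lemma has_ubound_integrals :
  has_ubound [set \int[rho]_x f x | rho in @invariant_measures R].
Proof.
have [M fM] := fullshift_bounded fc.
exists M => _ [rho _ <-].
rewrite -[leRHS]mulr1 -[X in _ * X]/(fine 1%E) -(@probability_setT _ _ _ rho).
rewrite -Rintegral_cst//.
have integ (u : fullshift -> R) : continuous u -> (forall x, `|u x| <= M) ->
    rho.-integrable [set: borel_fullshift] (EFin \o u).
  move=> uc uM; apply: measurable_bounded_integrable => //.
  - by apply: (le_lt_trans (probability_le1 rho measurableT)); rewrite ltry.
  - exact: continuous_borel_measurable.
  - by exists M; split; rewrite ?num_real// => N /ltW MN x _; apply: le_trans MN.
apply: le_Rintegral => //; first exact: integ.
  apply: (integ (fun=> M)) => [x|x]; first exact: cst_continuous.
  by rewrite ger0_norm// (le_trans _ (fM zeros)).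
by move=> x _; rewrite (le_trans (ler_norm _)).
Qed.

Lemma birkhoff_le_beta x n : iter n.+1 shiftmap x = x ->
  \sum_(i < n.+1) f (iter i shiftmap x) <= n.+1%:R * beta f.
Proof.
move=> px; rewrite -ler_pdivrMl// -integral_orbit_measure//.
apply: ub_le_sup; first exact: has_ubound_integrals.
by exists (orbit_measure x n) => //; exact: orbit_measure_invariant.
Qed.

(** Equality would make the orbit measure maximizing, hence a mixture of the two Dirac masses. These
    give mass 0 to the open set where coordinates [k] and 0 differ, whereas the orbit measure
    charges it at [x]. *)
Lemma birkhoff_lt_beta x n k : iter n.+1 shiftmap x = x ->
  x k != x 0%N ->
  (forall rho : probability borel_fullshift R, maximizing f rho ->
    exists s : R, 0 <= s <= 1 /\
      forall A : set borel_fullshift, measurable A ->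
        rho A = (s%:E * \d_(zeros : borel_fullshift) A
                 + (1 - s)%:E * \d_(ones : borel_fullshift) A)%E) ->
  \sum_(i < n.+1) f (iter i shiftmap x) < n.+1%:R * beta f.
Proof.
move=> px xk hmax; rewrite lt_neqAle birkhoff_le_beta// andbT.
apply/eqP => eqx; pose A : set fullshift := [set y | y k != y 0%N].
have mA : measurable (A : set borel_fullshift).
  apply: sub_sigma_algebra; rewrite openE => y /= yk; apply/nbhs_cylinderE.
  by exists k.+1 => y' yy'; rewrite /A /= !yy'.
have /hmax[s [_ /(_ _ mA)]] : maximizing f (orbit_measure x n).
  split; first exact: orbit_measure_invariant.
  by rewrite integral_orbit_measure// eqx mulKf.
change (orbit_measure x n A = (s%:E * \d_(zeros : borel_fullshift) A
  + (1 - s)%:E * \d_(ones : borel_fullshift) A)%E -> False).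
rewrite orbit_measureE !diracE !memNset /A /= ?eqxx// !mule0 adde0 => -[/eqP].
apply/negP; rewrite gt_eqF// mulr_gt0// big_ord_recl.
rewrite ltr_pwDl//; first by rewrite indicE mem_set.
by apply: sumr_ge0 => i _; rewrite indicE.
Qed.

End Beta.
End OrbitMeasure.

Lemma iter_shift_prepend w y : iter (size w) shiftmap (prepend w y) = y.
Proof.
elim: w => [|s w IH]; first by rewrite prepend_nil.
by rewrite [size _]/= iterSr prepend_cons; exact: IH.
Qed.

(** * Birkhoff sums along the periodic orbits of 0^(j+1) 1^(k+1) *)

Section PeriodicOrbit.
Context {R : realType} {f : fullshift -> R} {va vb : bool -> nat -> R}
  {la lb : bool -> R}.
Hypothesis hf : walters_sym f va vb la lb.

(** The shift shortens the block one letter at a time. The value at block length 1 is kept apart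
    because it depends on the next block. *)
Lemma birkhoff_block s m z :
  \sum_(i < m.+1) f (iter i shiftmap (block s m.+1 z)) =
  \sum_(1 <= i < m.+1) va s i.+1 + f (block s 1 z).
Proof.
elim: m => [|m IH]; first by rewrite big_ord1 big_geq// add0r.
rewrite big_ord_recl [X in f X]/= (wva hf)// big_nat_recr//= addrAC addrC.
congr (_ + _); rewrite -IH; apply: eq_bigr => i _.
by rewrite -iterS add0n iterSr block_cons.
Qed.

Let word j k := nseq j.+1 false ++ nseq k.+1 true.
Let orbit j k : fullshift := fun i => nth false (word j k) (i %% (j + k).+2).

Let size_word j k : size (word j k) = (j + k).+2.
Proof. by rewrite size_cat !size_nseq addSn addnS. Qed.

Let orbitE j k : orbit j k = prepend (word j k) (orbit j k).
Proof.
rewrite [LHS](@prepend_prefix (word j k)) => [|i iw].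
  by congr prepend; apply/funext => i; rewrite /orbit size_word modnDr.
by rewrite /orbit modn_small// -size_word.
Qed.

(** The sum over one period is compared with (j + k + 2) [beta f]. The term [vb true j.+1] comes
    from the last 1, which reads the following block of zeros, and is therefore grouped with the
    [va false] terms of that block; symmetrically for [vb false k.+1]. *)
Lemma alternating_orbit_lt (j k : nat) :
  (forall rho : probability borel_fullshift R, maximizing f rho ->
    exists s : R, 0 <= s <= 1 /\
      forall A : set borel_fullshift, measurable A ->
        rho A = (s%:E * \d_(zeros : borel_fullshift) A
                 + (1 - s)%:E * \d_(ones : borel_fullshift) A)%E) ->
  vb true j.+1 + \sum_(1 <= i < j.+1) va false i.+1 - j%:R * beta f +
  (vb false k.+1 + \sum_(1 <= i < k.+1) va true i.+1 - k%:R * beta f)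
  < 2 * beta f.
Proof.
move=> hmax; pose x := orbit j k.
have px : iter (j + k).+2 shiftmap x = x.
  by rewrite /x [in LHS]orbitE -size_word iter_shift_prepend.
have xj : x j.+1 != x 0%N.
  rewrite /x /orbit !modn_small; [|lia|lia].
  by rewrite /word !nth_cat !size_nseq ltnn subnn.
have := birkhoff_lt_beta (walters_continuous hf) px xj hmax.
pose y := shiftmap x; pose z := prepend (nseq k true) x.
have xy : x = scons false y by rewrite -[LHS]scons_shiftmap /x {1}/orbit mod0n.
have zx : scons true z = prepend (nseq k.+1 true) x by rewrite prepend_cons.
have zy : scons true z = block true k.+1 y.
  by rewrite block_prepend -xy zx.
have xz : x = block false j.+1 z.
  by rewrite block_prepend zx -prepend_cat; exact: orbitE.
have -> : (j + k).+2 = (j.+1 + k.+1)%N by lia.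
have jx : iter j.+1 shiftmap x = block true k.+1 y.
  rewrite -zy xz block_prepend -[X in iter X](size_nseq j.+1 false).
  exact: iter_shift_prepend.
have -> : \sum_(i < j.+1 + k.+1) f (iter i shiftmap x) =
    \sum_(i < j.+1) f (iter i shiftmap (block false j.+1 z)) +
    \sum_(i < k.+1) f (iter i shiftmap (block true k.+1 y)).
  rewrite -xz -jx big_split_ord; congr (_ + _); apply: eq_bigr => i _.
  by rewrite -iterD [(i + _)%N]addnC.
rewrite !birkhoff_block.
have -> : f (block false 1 z) = vb false k.+1.
  by rewrite block_cons block0 zy; exact: (wvb hf).
have -> : f (block true 1 y) = vb true j.+1.
  by rewrite block_cons block0 -xy xz; exact: (wvb hf).
by rewrite natrD -!natr1; lra.
Qed.

End PeriodicOrbit.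

(** * The equation for A *)

Section MaxTerm.
Context {R : realType}.
Implicit Types (w : nat -> R) (L x : R).

(* [max_term] as a function of A, for an abstract sequence [w] tending to [L]. *)
Definition sup_max w L x : R := Num.max (sup (range w)) (L - x).

Lemma has_sup_range w L : w @ \oo --> L -> has_sup (range w).
Proof.
move=> wL; split; first by exists (w 0%N), 0%N.
have /cvg_seq_bounded[M [_ HM]] : cvgn w by apply/cvg_ex; exists L.
exists (M + 1) => _ [n _ <-]; rewrite (le_trans (ler_norm _))//.
by apply: (HM (M + 1)) => //; rewrite ltrDl.
Qed.

Lemma le_sup_range w L n : w @ \oo --> L -> w n <= sup (range w).
Proof. by move=> /has_sup_range[_ ub]; apply: ub_le_sup => //; exists n. Qed.

Lemma lim_le_sup_range w L : w @ \oo --> L -> L <= sup (range w).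
Proof.
move=> wL; rewrite -(cvg_lim _ wL)//; apply: limr_le.
  by apply/cvg_ex; exists L.
by apply: nearW => n; exact: le_sup_range wL.
Qed.

(** Past some [N] the terms stay below the midpoint of [L] and the supremum, so the maximum over the
    first [N.+1] terms is the supremum. *)
Lemma sup_range_attained w L : w @ \oo --> L -> L < sup (range w) ->
  exists j, sup (range w) = w j.
Proof.
move=> wL LS; set S := sup _ in LS *.
have [N _ HN] : \forall n \near \oo, w n < (L + S) / 2.
  by apply: (cvgr_lt _ wL); lra.
pose j0 := [arg max_(i > (ord0 : 'I_N.+1)) w i]%O.
have j0P (i : 'I_N.+1) : w i <= w j0.
  by rewrite /j0; case: arg_maxP => // k _; apply.
exists j0; apply/le_anti; rewrite [X in _ && X](le_sup_range _ wL) andbT.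
rewrite leNgt; apply/negP => jS.
have : S <= Num.max (w j0) ((L + S) / 2).
  apply: ge_sup; first by exists (w 0%N), 0%N.
  move=> _ [n _ <-]; rewrite le_max; have [nN|nN] := ltnP n N.+1.
    by rewrite (j0P (Ordinal nN)).
  by rewrite (ltW (HN n (ltnW nN))) orbT.
by rewrite le_max => /orP[]; lra.
Qed.

Lemma sup_max_lip w L x y : `|sup_max w L x - sup_max w L y| <= `|x - y|.
Proof.
rewrite /sup_max; set S := sup _.
have := ler_norm (x - y); have := ler_norm (y - x); rewrite distrC ler_norml.
by have [] := leP S (L - x); have [] := leP S (L - y) => *; apply/andP; split; lra.
Qed.

Lemma sup_max_nonincreasing w L x y : x <= y -> sup_max w L y <= sup_max w L x.
Proof. by move=> xy; rewrite /sup_max ge_max !le_max lexx/= lerB ?orbT. Qed.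

Lemma sup_maxP w L x : [/\ sup (range w) <= sup_max w L x,
  L - x <= sup_max w L x &
  sup_max w L x = sup (range w) \/ sup_max w L x = L - x].
Proof.
rewrite /sup_max !le_max !lexx orbT; split=> //.
by case: leP => _; [right|left].
Qed.

(** * Existence, uniqueness and stability of the solution of [F x = B] *)

Section Balance.
Variables (u v : nat -> R) (U V B : R).
Hypotheses (uU : u @ \oo --> U) (vV : v @ \oo --> V)
  (uvB : forall j k, u j + v k < B).
Let F x := sup_max u U x + sup_max v V x.

Lemma sup_rangeD_le : sup (range u) + sup (range v) <= B.
Proof.
rewrite -lerBrDr; apply: ge_sup; first by exists (u 0%N), 0%N.
move=> _ [j _ <-]; rewrite lerBrDr addrC -lerBrDr.
apply: ge_sup; first by exists (v 0%N), 0%N.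
by move=> _ [k _ <-]; rewrite lerBrDr addrC ltW.
Qed.

Let F0_le : F 0 <= B.
Proof.
rewrite /F /sup_max !subr0 !max_l; first exact: sup_rangeD_le.
  exact: lim_le_sup_range.
exact: lim_le_sup_range.
Qed.

(** [F] is nonincreasing, so otherwise [F y = F x] and each of the two maxima is the same at [x] and
    [y], that is, equal to its supremum. As y < 0, both suprema exceed the limits, hence are
    attained, and two terms add up to [B] against [uvB]. *)
Lemma sup_max_eq_strict x y : y < x -> x <= 0 -> F x = B -> B < F y.
Proof.
move=> yx x0 FxB; have : F x <= F y by rewrite lerD// sup_max_nonincreasing// ltW.
rewrite le_eqVlt => /orP[/eqP FF|]; last by rewrite FxB.
have uS := lim_le_sup_range uU; have vS := lim_le_sup_range vV.
have [ux1 ux2 ux3] := sup_maxP u U x; have [uy1 uy2 uy3] := sup_maxP u U y.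
have [vx1 vx2 vx3] := sup_maxP v V x; have [vy1 vy2 vy3] := sup_maxP v V y.
(* If the supremum were only the limit [U], then y < 0 would put [U - y] strictly above it, and the
   first maximum would drop strictly from [y] to [x]. *)
have [uUS|uUS] := eqVneq (sup (range u)) U.
  move: FF sup_rangeD_le FxB; rewrite /F.
  by case: ux3; case: vx3; case: uy3; case: vy3; lra.
have [vVS|vVS] := eqVneq (sup (range v)) V.
  move: FF sup_rangeD_le FxB; rewrite /F.
  by case: ux3; case: vx3; case: uy3; case: vy3; lra.
have [j uj] := sup_range_attained uU ltac:(by rewrite lt_neqAle eq_sym uUS).
have [k vk] := sup_range_attained vV ltac:(by rewrite lt_neqAle eq_sym vVS).
have := uvB j k; rewrite -uj -vk; move: FF FxB; rewrite /F.
by case: ux3; case: vx3; case: uy3; case: vy3; lra.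
Qed.

(** Intermediate values: at 0 both maxima are the suprema, whose sum is at most [B], and far to the
    left the linear entries exceed [B]. *)
Lemma sup_max_balance_ex : exists2 x, x <= 0 & F x = B.
Proof.
(* Chosen so that (U - m) + (V - m) >= B. *)
pose m := - (`|B| + `|U| + `|V|).
have m0 : m <= 0 by rewrite oppr_le0 !addr_ge0.
have Fc : continuous F.
  move=> x; apply/cvgrPdist_le => e e0; near=> y.
  have -> : F x - F y = (sup_max u U x - sup_max u U y)
    + (sup_max v V x - sup_max v V y) by rewrite /F; ring.
  rewrite (le_trans (ler_normD _ _))// (splitr e) lerD//;
    apply: (le_trans (sup_max_lip _ _ _ _)); near: y.
    apply: cvgr_dist_le (divr_gt0 e0 (ltr0Sn _ 1)); exact: cvg_id.
  apply: cvgr_dist_le (divr_gt0 e0 (ltr0Sn _ 1)); exact: cvg_id.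
have BF : B <= F m.
  have : (U - m) + (V - m) <= F m by rewrite lerD// /sup_max le_max lexx orbT.
  have := ler_norm B; have := ler_norm (- U); have := ler_norm (- V).
  have mE : m = - (`|B| + `|U| + `|V|) by [].
  have := normr_ge0 B; rewrite !normrN => *; lra.
have mB : Num.min (F m) (F 0) <= B <= Num.max (F m) (F 0).
  by rewrite ge_min le_max F0_le BF orbT.
have [x /itvP x0 Fx] := IVT m0 (continuous_subspaceT Fc) mB.
by exists x; rewrite ?x0.
Unshelve. all: end_near. Qed.

Lemma sup_max_balance_unique x y : x <= 0 -> y <= 0 -> F x = B -> F y = B ->
  x = y.
Proof.
move=> x0 y0 Fx Fy; case: (ltgtP x y) => // xy.
  by have := sup_max_eq_strict xy y0 Fy; rewrite Fx ltxx.
by have := sup_max_eq_strict xy x0 Fx; rewrite Fy ltxx.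
Qed.

(** [F (x - e)] is strictly above [B], which bounds [g] from below. From above, either x + e <= 0
    and [F (x + e)] is strictly below [B], or the bound g <= 0 already suffices. *)
Lemma sup_max_balance_cvg (T : Type) (G : set_system T) {FG : Filter G}
    (g : T -> R) x : x <= 0 -> F x = B ->
  (\forall t \near G, g t <= 0) -> F (g t) @[t --> G] --> B ->
  g t @[t --> G] --> x.
Proof.
move=> x0 Fx g0 gB; apply/cvgrPdist_le => e e0.
have Fe : B < F (x - e) by apply: sup_max_eq_strict x0 Fx; rewrite ltrBlDr ltrDl.
have [xe|xe] := leP (x + e) 0.
  have FeB : F (x + e) < B.
    rewrite lt_neqAle; apply/andP; split.
      apply/eqP => Fxe; have := sup_max_balance_unique x0 xe Fx Fxe; lra.
    by rewrite -Fx lerD// sup_max_nonincreasing// lerDl ltW.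
  near=> t.
  have H1 : F (g t) < F (x - e) by near: t; exact: (cvgr_lt _ gB).
  have H2 : F (x + e) < F (g t) by near: t; exact: (cvgr_gt _ gB).
  rewrite ler_norml; apply/andP; split; rewrite leNgt; apply/negP => Hlt.
    suff : F (g t) <= F (x + e) by lra.
    by rewrite lerD// sup_max_nonincreasing//; lra.
  suff : F (x - e) <= F (g t) by lra.
  by rewrite lerD// sup_max_nonincreasing//; lra.
near=> t.
have H1 : F (g t) < F (x - e) by near: t; exact: (cvgr_lt _ gB).
have H2 : g t <= 0 by near: t.
rewrite ler_norml; apply/andP; split; first lra.
rewrite leNgt; apply/negP => Hlt.
suff : F (x - e) <= F (g t) by lra.
by rewrite lerD// sup_max_nonincreasing//; lra.
Unshelve. all: end_near. Qed.

End Balance.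
End MaxTerm.

(** * Exponential series with a geometric tail *)

Section ExpSeries.
Context {R : realType}.
Variables (w : nat -> R) (L : R).
Hypothesis wL : w @ \oo --> L.

Definition exp_series (t r : R) (n : nat) : R :=
  \sum_(0 <= j < n) expR (t * w j) * r ^+ j.

Lemma geometric_sum (r : R) n : r != 1 ->
  \sum_(0 <= j < n) r ^+ j = (1 - r ^+ n) / (1 - r).
Proof.
move=> r1; apply: (@mulIf _ (r - 1)); first by rewrite subr_eq0.
rewrite big_mkord mulrC -subrX1.
by field; rewrite subr_eq0 eq_sym.
Qed.

Section Bounds.
Variables (t r al : R).
Hypotheses (t0 : 0 < t) (r0 : 0 < r) (r1 : r < 1)
  (hal : exp_series t r @ \oo --> al).

Let term_gt0 j : 0 < expR (t * w j) * r ^+ j.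
Proof. by rewrite mulr_gt0 ?expR_gt0 ?exprn_gt0. Qed.

Let hal_cvg : cvgn (exp_series t r).
Proof. by apply/cvg_ex; exists al. Qed.

Let halE : limn (exp_series t r) = al.
Proof. exact: cvg_lim hal. Qed.

Lemma exp_series_term_le j : expR (t * w j) * r ^+ j <= al.
Proof.
rewrite -halE; apply: limr_ge => //; exists j.+1 => // n /= jn.
rewrite /exp_series (big_cat_nat _ jn)//= big_nat_recr//=.
rewrite -[leLHS]add0r -addrA lerD//; first by apply: sumr_ge0 => i _; exact: ltW.
by rewrite lerDl; apply: sumr_ge0 => i _; exact: ltW.
Qed.

Lemma exp_series_gt0 : 0 < al.
Proof. exact: lt_le_trans (term_gt0 0) (exp_series_term_le 0). Qed.

(** The first [N] terms are bounded through the supremum and r^j <= 1, the others by a full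
    geometric series. *)
Lemma exp_series_le (N : nat) K : (forall j, (N <= j)%N -> w j <= K) ->
  al <= N%:R * expR (t * sup (range w)) + expR (t * K) / (1 - r).
Proof.
move=> wK; rewrite -halE; apply: limr_le => //; apply: nearW => n.
apply: (@le_trans _ _ (\sum_(0 <= j < n) ((j < N)%:R * expR (t * sup (range w))
   + expR (t * K) * r ^+ j))).
  apply: ler_sum => j _; have rj : 0 <= r ^+ j by rewrite exprn_ge0// ltW.
  case: ltnP => jN /=.
    rewrite mul1r -[leLHS]addr0 lerD//; last by rewrite mulr_ge0// expR_ge0.
    rewrite -[leRHS]mulr1 ler_pM ?expR_ge0//; last by rewrite exprn_ile1// ltW.
    by rewrite ler_expR ler_pM2l// (le_sup_range _ wL).
  by rewrite mul0r add0r ler_wpM2r// ler_expR ler_pM2l// wK.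
rewrite big_split/= -mulr_suml -mulr_sumr lerD//.
  rewrite ler_wpM2r ?expR_ge0// -natr_sum ler_nat.
  rewrite (leq_trans _ (_ : \sum_(0 <= j < n + N) (j < N) <= N)%N)//.
    by rewrite (@big_cat_nat _ _ _ n 0 (n + N)) ?leq_addr//= leq_addr.
  rewrite (@big_cat_nat _ _ _ N) ?leq_addl//= [X in (_ + X)%N]big_nat_cond.
  rewrite [X in (_ + X)%N]big1 ?addn0 => [|j /andP[/andP[Nj _] _]]; last first.
    by rewrite ltnNge Nj.
  rewrite (leq_trans (_ : _ <= \sum_(0 <= j < N) 1)%N)//.
    by apply: leq_sum => j _; case: ltnP.
  by rewrite sum_nat_const_nat subn0 muln1.
rewrite geometric_sum ?lt_eqF// ler_wpM2l ?expR_ge0//.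
rewrite -[leRHS]mul1r ler_wpM2r ?invr_ge0 ?subr_ge0 ?(ltW r1)//.
by rewrite gerBl exprn_ge0// ltW.
Qed.

Lemma exp_series_le_sup : al <= expR (t * sup (range w)) / (1 - r).
Proof.
have := @exp_series_le 0 (sup (range w)) (fun j _ => le_sup_range j wL).
by rewrite mul0r add0r.
Qed.

(** Only the terms from [N] on are kept; they dominate a geometric series starting at r^N. *)
Lemma exp_series_ge (N : nat) K : (forall j, (N <= j)%N -> K <= w j) ->
  expR (t * K) * (r ^+ N / (1 - r)) <= al.
Proof.
move=> wK.
have geoc : expR (t * K) * (r ^+ N * ((1 - r ^+ n) / (1 - r))) @[n --> \oo]
    --> expR (t * K) * (r ^+ N * ((1 - 0) / (1 - r))).
  apply: cvgMl_tmp; apply: cvgMl_tmp; apply: cvgMr_tmp; apply: cvgB.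
    exact: cvg_cst.
  by apply: cvg_expr; rewrite gtr0_norm.
rewrite subr0 mul1r in geoc; apply: (ler_cvg_to geoc (cvg_cst al)).
apply: nearW => n; rewrite -geometric_sum ?lt_eqF// mulr_sumr mulr_sumr.
rewrite -halE; apply: limr_ge => //; exists (n + N)%N => // m /= nm.
rewrite /exp_series [leRHS](@big_cat_nat _ _ _ N) ?(leq_trans _ nm) ?leq_addl//=.
rewrite -[leLHS]add0r lerD//; first by apply: sumr_ge0 => i _; exact: ltW.
rewrite [leRHS](@big_cat_nat _ _ _ (n + N)) ?leq_addl//=.
rewrite -[leLHS]addr0 lerD//; last by apply: sumr_ge0 => i _; exact: ltW.
have -> : \sum_(N <= j < n + N) expR (t * w j) * r ^+ j =
    \sum_(0 <= j < n) expR (t * w (j + N)%N) * r ^+ (j + N).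
  by rewrite -[X in \big[_/_]_(X <= _ < _) _]add0n big_addn addnK.
apply: ler_sum => j _.
rewrite -exprD addnC ler_wpM2r ?exprn_ge0// ?(ltW r0)//.
by rewrite ler_expR ler_pM2l// wK// leq_addl.
Qed.

End Bounds.

(** A single term gives the supremum and the geometric tail gives [L - x]. Since r >= 1/2, the
    factors 1/r and r^N with [N] fixed are bounded away from 0 and infinity uniformly in [t], so
    they vanish after taking [ln] and dividing by [t]. *)
Lemma exp_series_asymptotics (r al : R -> R) :
  (forall t, 0 < t -> 2^-1 <= r t < 1) ->
  (forall t, 0 < t -> exp_series t (r t) @ \oo --> al t) ->
  ln (al t) / t - sup_max w L (ln ((r t)^-1 - 1) / t) @[t --> +oo] --> 0.
Proof.
move=> hr hal; apply/cvgrPdist_le => e e0.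
have e20 : 0 < e / 2 by lra.
have [Nu _ HNu] : \forall n \near \oo, w n <= L + e / 2.
  by apply: (cvgr_le _ wL); lra.
have [Nl _ HNl] : \forall n \near \oo, L - e / 2 <= w n.
  by apply: (cvgr_ge _ wL); lra.
have [_ [j0 _ <-] Hj0] := sup_adherent e20 (has_sup_range wL).
set S := sup _ in Hj0.
have large C : \forall t \near +oo, C <= t * (e / 2).
  have := @nbhs_pinfty_ge R (C / (e / 2)) (num_real _).
  by apply: filterS => t; rewrite ler_pdivrMr.
near=> t.
have t0 : 0 < t by near: t; exact: nbhs_pinfty_gt.
have /andP[r2 r1] := hr t t0.
have r0 : 0 < r t by lra.
have al0 := exp_series_gt0 r0 (hal t t0).
set x := ln (_ - 1) / t.
(* This turns the geometric factor 1 / (1 - r) into the shift by [- x] in [sup_max]. *)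
have ex : expR (- (t * x)) = r t / (1 - r t).
  rewrite expRN [t * x]mulrC divfK ?gt_eqF// lnK ?posrE ?subr_gt0 ?invf_gt1//.
  have -> : (r t)^-1 - 1 = (1 - r t) / r t by field; rewrite gt_eqF.
  exact: invf_div.
have [Sx Lx xcase] := sup_maxP w L x; rewrite -/S in Sx xcase.
set G := sup_max _ _ _ in Sx Lx xcase *.
suff : t * (G - e) <= ln (al t) <= t * (G + e).
  move=> /andP[lo up]; rewrite sub0r normrN ler_norml; apply/andP; split.
    by rewrite lerBrDr addrC ler_pdivlMr// mulrC.
  by rewrite lerBlDr ler_pdivrMr// mulrC addrC.
apply/andP; split.
  (* Both lower bounds, by one term and by the tail, have the form e^(t K) r^N, and r^N >=
     2^(-N). *)
  have lowpow N K : expR (t * K) * r t ^+ N <= al t -> G - e / 2 <= K ->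
      N%:R * ln 2 <= t * (e / 2) -> t * (G - e) <= ln (al t).
    move=> Kal GK Nt; rewrite -ler_expR lnK ?posrE//; apply: le_trans Kal.
    have rN : expR (- (N%:R * ln 2)) <= r t ^+ N.
      rewrite -mulrN expRM_natl -lnV ?posrE// lnK ?posrE ?invr_gt0//.
      by rewrite lerXn2r ?nnegrE ?invr_ge0// ltW.
    rewrite (le_trans _ (ler_wpM2l (expR_ge0 _) rN))// -expRD ler_expR.
    have := ler_wpM2l (ltW t0) GK; lra.
  case: xcase => GE.
    apply: (lowpow j0 (w j0)); first exact: exp_series_term_le (hal t t0) _.
      by rewrite GE ltW.
    by near: t; exact: large.
  apply: (lowpow Nl (L - e / 2 - x)); last by near: t; exact: large.
    apply: le_trans (exp_series_ge t0 r0 r1 (hal t t0) HNl).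
    have -> : t * (L - e / 2 - x) = t * (L - e / 2) + - (t * x) by ring.
    rewrite expRD -mulrA ler_wpM2l ?expR_ge0// ex mulrC.
    by rewrite ler_wpM2l ?exprn_ge0 ?(ltW r0)// ler_piMl ?(ltW r1)//
      invr_ge0 subr_ge0 ltW.
  by rewrite GE; lra.
rewrite -ler_expR lnK ?posrE//.
apply: le_trans (exp_series_le t0 r0 r1 (hal t t0) HNu) _.
(* The factor 2 bounds 1/r. *)
have tailE : expR (t * (L + e / 2)) / (1 - r t) <= 2 * expR (t * (G + e / 2)).
  have -> : (1 - r t)^-1 = (r t)^-1 * expR (- (t * x)).
    by rewrite ex; field; lra.
  rewrite mulrCA -expRD ler_pM ?invr_ge0 ?expR_ge0// ?(ltW r0)//.
    by rewrite -[leRHS]invrK lef_pV2 ?posrE ?invr_gt0.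
  by rewrite ler_expR -mulrBr ler_pM2l//; lra.
have headE : Nu%:R * expR (t * S) <= Nu%:R * expR (t * (G + e / 2)).
  by rewrite ler_wpM2l// ler_expR ler_pM2l//; lra.
apply: le_trans (lerD headE tailE) _; rewrite -mulrDl.
have -> : t * (G + e) = t * (e / 2) + t * (G + e / 2) by field.
rewrite expRD ler_wpM2r ?expR_ge0//.
have N0 : 0 < Nu%:R + 2 :> R by rewrite ltr_wpDl.
rewrite -[leLHS]lnK ?posrE// ler_expR.
by near: t; exact: large.
Unshelve. all: end_near. Qed.

End ExpSeries.

(** * The zero-temperature limit *)

Section BlockSeries.
Context {R : realType} {f : fullshift -> R} {va vb : bool -> nat -> R}
  {la lb : bool -> R} {be : R}.
Hypotheses (hf : walters_sym f va vb la lb) (la_be : forall s, la s = be)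
  (va_summable : forall s, cvgn (fun N => \sum_(2 <= n < N) (va s n - be))).

(** With the families of [walters_class_sym], [false] gives the (d, a) expression and [true] the (b,
    c) one, convertibly with the supremum in [max_term]. *)
Definition block_weight s q j : R :=
  vb (~~ s) (q + j) + \sum_(1 <= i < j.+1) va s (q + i)%N - j%:R * be.

Definition block_weight_lim s q : R :=
  lb (~~ s) + limn (fun N => \sum_(1 <= j < N) (va s (q + j)%N - be)).

Let tail s q N := \sum_(1 <= j < N) (va s (q + j)%N - be).

Let block_weightE s q j :
  block_weight s q j = vb (~~ s) (q + j) + tail s q j.+1.
Proof.
rewrite /block_weight /tail sumrB sumr_const_nat subSS subn0.
by rewrite -[be *+ _]mulr_natl addrA.
Qed.

Let tail_cvg s q : (1 <= q)%N -> cvgn (tail s q).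
Proof.
move=> q1; pose S N := \sum_(2 <= i < N) (va s i - be).
(* The tail is a difference of partial sums of the given series, which starts at index 2; hence q >=
   1. *)
apply/cvg_ex; exists (limn S - S q.+1); rewrite -cvg_shiftS.
rewrite (_ : (fun n => tail s q n.+1) = fun n => S (n + q.+1)%N - S q.+1).
  apply: cvgB; last exact: cvg_cst.
  by rewrite (cvg_shiftn q.+1 S); exact: va_summable.
apply/funext => n; rewrite /S (@big_cat_nat _ _ _ q.+1 2 (n + q.+1))/=; [|lia|lia].
rewrite addrAC subrr add0r /tail -[n.+1]addn1.
rewrite -[X in \big[_/_]_(X <= _ < _ + 1) _]add0n big_addn addnK.
rewrite -[X in \big[_/_]_(X <= _ < _ + _.+1) _]add0n big_addn addnK.
by apply: eq_bigr => i _; rewrite addn1 addnS addnS addnC.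
Qed.

Lemma block_weight_cvg s q : (1 <= q)%N ->
  block_weight s q @ \oo --> block_weight_lim s q.
Proof.
move=> q1; rewrite (_ : block_weight s q = fun j =>
    vb (~~ s) (j + q)%N + tail s q j.+1); last first.
  by apply/funext => j; rewrite block_weightE addnC.
apply: cvgD; first by rewrite (cvg_shiftn q (vb (~~ s))); exact: wcvgb hf _.
by rewrite (cvg_shiftS (tail s q)); exact: tail_cvg.
Qed.

Section Eigen.
Context {t lam : R} {h : fullshift -> R}.
Hypotheses (hc : continuous h) (h_gt0 : forall x, 0 < h x)
  (h_eig : forall x, ruelle t f h x = lam * h x).

Let r := expR (t * be) / lam.
Let H s q := h (block s q zeros).
Let lam0 : 0 < lam := eigenvalue_gt0 h_gt0 h_eig.
Let r_gt0 : 0 < r. Proof. by rewrite divr_gt0// expR_gt0. Qed.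

(** The right side is positive, which yields r < 1. The identity also links the values at the
    constant sequences to those on blocks of length 1. *)
Lemma eigen_const_gap s : lam * (1 - r) * h (const_seq s) =
  expR (t * lb (~~ s)) * h (block (~~ s) 1 zeros).
Proof.
have := eigen_const hf hc h_gt0 h_eig s; rewrite la_be => E.
have -> : lam * (1 - r) = lam - expR (t * be) by rewrite /r; field; rewrite gt_eqF.
by rewrite mulrBl E; ring.
Qed.

Lemma eigen_ratio_lt1 : r < 1.
Proof.
have : 0 < lam * (1 - r) * h (const_seq true).
  by rewrite eigen_const_gap mulr_gt0// expR_gt0.
by rewrite -mulrA pmulr_rgt0// pmulr_lgt0// subr_gt0.
Qed.

(** Dividing [eigen_recursion] by [K] gives an affine recursion for [X], and unfolding it [n] times
    leaves the partial sum and a remainder that vanishes. *)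
Lemma block_series_cvg s q : (1 <= q)%N ->
  exp_series (block_weight s q) t r @ \oo --> lam * H s q / H (~~ s) 1.
Proof.
move=> q1; set K := H (~~ s) 1; have K0 : 0 < K by exact: h_gt0.
pose X m := lam * H s m / K.
have Xrec m : (1 <= m)%N ->
    X m = expR (t * vb (~~ s) m) + r * expR (t * (va s m.+1 - be)) * X m.+1.
  move=> m1; rewrite /X (eigen_recursion hf hc h_gt0 h_eig)// -/(H _ _) -/(H _ _) -/K.
  rewrite mulrBr expRD expRN /r; field.
  by rewrite !gt_eqF// expR_gt0.
have XE n : exp_series (block_weight s q) t r n
    = X q - r ^+ n * expR (t * tail s q n.+1) * X (q + n)%N.
  elim: n => [|n IH].
    by rewrite /exp_series /tail !big_geq// mulr0 expR0 expr0 addn0; ring.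
  rewrite /exp_series big_nat_recr//= -/(exp_series _ _ _ _) IH.
  rewrite block_weightE /tail [in RHS]big_nat_recr//= -/(tail s q n.+1).
  rewrite (Xrec (q + n)%N) ?(leq_trans q1) ?leq_addr// addnS !mulrDr !expRD exprS.
  ring.
rewrite -[lam * _ / _]subr0; move/funext: XE => ->.
apply: cvgB; first exact: cvg_cst.
(* In the remainder r^n tends to 0, while the exponential of the tail and [X (q + n)] converge, the
   latter by continuity of [h] at the constant sequence. *)
have -> : 0 = 0 * expR (t * limn (tail s q)) * (lam * h (const_seq s) / K).
  by rewrite !mul0r.
apply: cvgM; first apply: cvgM.
- by apply: cvg_expr; rewrite gtr0_norm// eigen_ratio_lt1.
- apply: continuous_cvg; first exact: continuous_expR.
  apply: cvgMl_tmp; rewrite (cvg_shiftS (tail s q)).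
  exact: tail_cvg.
- apply: cvgMr_tmp; apply: cvgMl_tmp.
  rewrite (_ : (fun n => H s (q + n)%N) = fun n => H s (n + q)%N).
    by rewrite (cvg_shiftn q (H s)); exact: eigenfunction_block_cvg.
  by apply/funext => n; rewrite addnC.
Qed.

End Eigen.
End BlockSeries.

Arguments block_weight {R} va vb be s q j.
Arguments block_weight_lim {R} va lb be s q.

(** * Asymptotics of the eigenvalue and of the eigenfunctions *)

Section ZeroTemperature.
Context {R : realType} {f : fullshift -> R} {va vb : bool -> nat -> R}
  {la lb : bool -> R}.
Hypotheses (hf : walters_sym f va vb la lb) (la_beta : forall s, la s = beta f)
  (va_summable : forall s,
     cvgn (fun N => \sum_(2 <= n < N) (va s n - beta f)))
  (W_lt : forall j k, block_weight va vb (beta f) false 1 j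
     + block_weight va vb (beta f) true 1 k < 2 * beta f).

Let W s q := block_weight va vb (beta f) s q.
Let WL s q := block_weight_lim va lb (beta f) s q.
Let M s q x := sup_max (W s q) (WL s q) x.

Let W_cvg s q : (1 <= q)%N -> W s q @ \oo --> WL s q.
Proof. by move=> q1; exact: (block_weight_cvg hf va_summable). Qed.

Variables (A : R) (h : R -> fullshift -> R).
Hypotheses (A_le0 : A <= 0) (AE : M false 1 A + M true 1 A = 2 * beta f)
  (hh : forall t, 0 < t -> normalized_eigenfunction t f (h t)).

Let lam t := expR (fine (pressure t f)).
Let r t := expR (t * beta f) / lam t.
Let H t s q := h t (block s q zeros).
Let X s q t := lam t * H t s q / H t (~~ s) 1.
(** This is A_t, the approximate solution of the equation for [A]. *)
Let g t := ln ((r t)^-1 - 1) / t.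

Let h_gt0 t x : 0 < t -> 0 < h t x. Proof. by move=> /hh[]. Qed.

Let r_gt0 t : 0 < r t. Proof. by rewrite divr_gt0 ?expR_gt0. Qed.

Let r_lt1 t : 0 < t -> r t < 1.
Proof. by move=> /hh[hc h0 he _]; exact (eigen_ratio_lt1 hf la_beta hc h0 he). Qed.

Let gap_gt0 t : 0 < t -> 0 < (r t)^-1 - 1.
Proof. by move=> t0; rewrite subr_gt0 invf_gt1// r_lt1. Qed.

Let X_cvg s q t : 0 < t -> (1 <= q)%N ->
  exp_series (W s q) t (r t) @ \oo --> X s q t.
Proof.
move=> /hh[hc h0 he _] q1.
exact (block_series_cvg hf la_beta va_summable hc h0 he q1).
Qed.

Let XX t : 0 < t -> X false 1 t * X true 1 t = lam t ^+ 2.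
Proof.
by move=> t0; rewrite /X /=; field; rewrite !gt_eqF// h_gt0.
Qed.

(** Multiplying the two upper bounds of the series gives lam^2 <= e^(2 t beta) / (1 - r)^2, as the
    suprema add up to at most 2 beta. Hence lam (1 - r) <= e^(t beta) = lam r. *)
Let r_ge_half t : 0 < t -> 2^-1 <= r t.
Proof.
move=> t0; have r1 := r_lt1 t0; have r0 := r_gt0 t.
have Xle s := exp_series_le_sup (@W_cvg s 1 isT) t0 r0 r1 (@X_cvg s 1 t t0 isT).
have X0 s := exp_series_gt0 r0 (@X_cvg s 1 t t0 isT).
have := ler_pM (ltW (X0 false)) (ltW (X0 true)) (Xle false) (Xle true).
rewrite XX// mulrACA -expRD -mulrDr -expr2 exprVn => XXle.
have : lam t ^+ 2 <= expR (t * beta f) ^+ 2 * ((1 - r t) ^+ 2)^-1.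
  apply: le_trans XXle _; rewrite ler_wpM2r ?invr_ge0 ?sqr_ge0//.
  rewrite expr2 -expRD ler_expR -mulrDr ler_pM2l// -mulr2n -mulr_natl.
  exact: sup_rangeD_le W_lt.
have lE : lam t = expR (t * beta f) / r t.
  by rewrite /r; field; rewrite !gt_eqF ?expR_gt0.
rewrite ler_pdivlMr ?exprn_gt0 ?subr_gt0// -exprMn.
rewrite ler_pXn2r ?nnegrE ?expR_ge0 ?mulr_ge0 ?subr_ge0 ?(ltW r1) ?expR_ge0//.
rewrite lE mulrAC ler_pdivrMr// ler_pM2l ?expR_gt0//; lra.
Qed.

Let asym s q : (1 <= q)%N ->
  ln (X s q t) / t - M s q (g t) @[t --> +oo] --> 0.
Proof.
move=> q1; refine (exp_series_asymptotics (@W_cvg s q q1) _ _) => t t0.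
  by rewrite r_ge_half// r_lt1.
exact: X_cvg.
Qed.

Let ln_lam_cvg : ln (lam t) / t @[t --> +oo] --> beta f.
Proof.
apply/cvgrPdist_le => e e0; near=> t.
have t0 : 0 < t by near: t; exact: nbhs_pinfty_gt.
(* The error is [ln (r t) / t] with [ln (r t)] between - ln 2 and 0. *)
have -> : beta f - ln (lam t) / t = ln (r t) / t.
  rewrite /r ln_div ?posrE ?expR_gt0// expRK; field; exact: lt0r_neq0.
have lr : - ln 2 <= ln (r t).
  by rewrite -lnV ?posrE// ler_ln ?posrE ?invr_gt0// r_ge_half.
have lr0 : ln (r t) <= 0 by rewrite ln_le0// ltW// r_lt1.
rewrite normrM normfV (gtr0_norm t0) ler_pdivrMr// ler0_norm//.
have : ln 2 / e <= t by near: t; apply: nbhs_pinfty_ge; exact: num_real.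
by rewrite ler_pdivrMr// => ?; lra.
Unshelve. all: end_near. Qed.

Let M_cvg s q (G : set_system R) {FG : Filter G} (u : R -> R) x :
  u t @[t --> G] --> x -> M s q (u t) @[t --> G] --> M s q x.
Proof.
move=> /cvgrPdist_le ux; apply/cvgrPdist_le => e /ux.
by apply: filterS => t; apply: le_trans; exact: sup_max_lip.
Qed.

Let pos_near (P : R -> Prop) : (forall t, 0 < t -> P t) -> \forall t \near +oo, P t.
Proof. by move=> HP; apply: filterS (nbhs_pinfty_gt (num_real 0)) => t /HP. Qed.

Let cvg_pos_ext (u v : R -> R) (l : R) : u t @[t --> +oo] --> l ->
  (forall t, 0 < t -> u t = v t) -> v t @[t --> +oo] --> l.
Proof.
move=> ul uv; apply: cvg_trans ul; apply: near_eq_cvg.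
by apply: pos_near => t /uv.
Qed.

(** By [XX] and [asym] the balance function at [g t] is 2 ln lam / t up to vanishing errors, so it
    tends to 2 beta; r >= 1/2 gives g <= 0, and stability of the balance equation applies. *)
Let g_cvg : g t @[t --> +oo] --> A.
Proof.
apply: (sup_max_balance_cvg (@W_cvg false 1 isT) (@W_cvg true 1 isT) W_lt A_le0 AE).
  apply: pos_near => t t0; rewrite mulr_le0_ge0 ?invr_ge0 ?(ltW t0)//.
  rewrite ln_le0// lerBlDr -[leRHS]invrK lef_pV2 ?posrE//.
  by rewrite (le_trans _ (r_ge_half t0)).
have -> : 2 * beta f = 2 * beta f - 0 - 0 by rewrite !subr0.
refine (cvg_pos_ext (cvgB (cvgB (cvgMl_tmp (a := 2) ln_lam_cvg)
  (@asym false 1 isT)) (@asym true 1 isT)) _) => t t0.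
have : ln (X false 1 t) + ln (X true 1 t) = 2 * ln (lam t).
  rewrite -lnM ?posrE ?divr_gt0 ?mulr_gt0 ?h_gt0 ?expR_gt0//.
  by rewrite XX// lnXn ?expR_gt0// mulr_natl.
move=> lX; rewrite !fctE /= /M.
have -> : 2 * (ln (lam t) / t) = ln (X false 1 t) / t + ln (X true 1 t) / t.
  by rewrite mulrA -lX mulrDl.
ring.
Qed.

Let const_gap t s : 0 < t -> expR (t * beta f) * ((r t)^-1 - 1) * h t (const_seq s)
  = expR (t * lb (~~ s)) * H t (~~ s) 1.
Proof.
move=> t0; have [hc h0 he _] := hh t0.
rewrite -(eigen_const_gap hf la_beta hc h0 he s) -/(lam t) -/(r t).
congr (_ * _); rewrite /r; field.
by rewrite !gt_eqF ?expR_gt0.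
Qed.

Let ln_const_gap t s : 0 < t ->
  ln (h t (const_seq s)) / t = lb (~~ s) + ln (H t (~~ s) 1) / t - beta f - g t.
Proof.
move=> t0; have /(congr1 (@ln R)) := const_gap s t0.
rewrite !lnM ?posrE ?mulr_gt0 ?expR_gt0 ?h_gt0 ?gap_gt0// !expRK => E.
have -> : ln (h t (const_seq s)) = t * lb (~~ s) + ln (H t (~~ s) 1)
  - t * beta f - ln ((r t)^-1 - 1) by rewrite -E; ring.
by rewrite /g; field; exact: lt0r_neq0.
Qed.

(** The term [M s q (g t)] is inserted so that [asym] and [M_cvg] apply separately. *)
Let ln_block t s q : 0 < t -> ln (H t s q) / t =
  ln (X s q t) / t - M s q (g t) + M s q (g t) - ln (lam t) / t + ln (H t (~~ s) 1) / t.
Proof.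
move=> t0; rewrite /X ln_div ?lnM ?posrE ?mulr_gt0 ?h_gt0 ?expR_gt0//.
by field; exact: lt0r_neq0.
Qed.

(** The normalization at 0^oo enters here, through [ln_const_gap] at [false]; all other limits are
    derived from this one. *)
Let H1_cvg : ln (H t true 1) / t @[t --> +oo] --> A - lb true + beta f.
Proof.
refine (cvg_pos_ext (cvgD (cvgB g_cvg (cvg_cst (lb true))) (cvg_cst (beta f))) _) => t t0.
have := ln_const_gap false t0; have [_ _ _ h1] := hh t0.
by rewrite (h1 : h t (const_seq false) = 1) ln1 mul0r !fctE => E; lra.
Qed.

Lemma block_false_cvg q z : (1 <= q)%N ->
  t^-1 * ln (h t (block false q z)) @[t --> +oo] --> A - lb true + M false q A.
Proof.
move=> q1.
have -> : A - lb true + M false q A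
  = 0 + M false q A - beta f + (A - lb true + beta f) by ring.
refine (cvg_pos_ext (cvgD (cvgB (cvgD (@asym false q q1)
  (@M_cvg false q _ _ _ _ g_cvg)) ln_lam_cvg) H1_cvg) _) => t t0.
have [hc h0 he _] := hh t0.
by rewrite (eigenfunction_block hf hc h0 he _ z zeros q1) [RHS]mulrC -/(H _ _ _)
  [RHS]ln_block.
Qed.

(** Here [ln_block] refers back to the block 0 1, whose limit is [block_false_cvg] at q = 1. *)
Lemma block_true_cvg q z : (1 <= q)%N ->
  t^-1 * ln (h t (block true q z)) @[t --> +oo]
  --> - lb true - beta f + A + M false 1 A + M true q A.
Proof.
move=> q1.
have -> : - lb true - beta f + A + M false 1 A + M true q A
  = 0 + M true q A - beta f + (A - lb true + M false 1 A) by ring.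
refine (cvg_pos_ext (cvgD (cvgB (cvgD (@asym true q q1)
  (@M_cvg true q _ _ _ _ g_cvg)) ln_lam_cvg)
  (@block_false_cvg 1 zeros isT)) _) => t t0.
have [hc h0 he _] := hh t0.
by rewrite (eigenfunction_block hf hc h0 he _ z zeros q1) [RHS]mulrC -/(H _ _ _)
  [RHS]ln_block// [ln (H _ (~~ _) 1) / _]mulrC.
Qed.

Lemma ones_cvg :
  t^-1 * ln (h t ones) @[t --> +oo] --> lb false - lb true - beta f + M false 1 A.
Proof.
have -> : lb false - lb true - beta f + M false 1 A
  = lb false + (A - lb true + M false 1 A) - beta f - A by ring.
refine (cvg_pos_ext (cvgB (cvgB (cvgD (cvg_cst (lb false)) (@block_false_cvg 1 zeros isT))
  (cvg_cst (beta f))) g_cvg) _) => t t0.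
by rewrite -[ones]/(const_seq true) [RHS]mulrC [RHS]ln_const_gap//
  [ln (H _ _ 1) / _]mulrC.
Qed.

Lemma zeros_cvg : t^-1 * ln (h t zeros) @[t --> +oo] --> (0 : R).
Proof.
refine (cvg_pos_ext (cvg_cst 0) _) => t t0.
by have [_ _ _ ->] := hh t0; rewrite ln1 mulr0.
Qed.

End ZeroTemperature.

Theorem theorem2 (R : realType) (f : fullshift -> R)
    (a_ b_ c_ d_ : nat -> R) (a b c d : R)
    (hf : walters_summable f a_ b_ c_ d_ a b c d)
    (ha : a = beta f) (hc : c = beta f)
    (hmax : forall rho : probability borel_fullshift R, maximizing f rho ->
      exists s : R, 0 <= s <= 1 /\
        forall A : set borel_fullshift, measurable A ->
          rho A = (s%:E * \d_(zeros : borel_fullshift) A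
                   + (1 - s)%:E * \d_(ones : borel_fullshift) A)%E) :
  exists A : R,
    unique (fun A' : R => A' <= 0 /\
      2 * beta f = max_term d_ d a_ (beta f) A' 1
                   + max_term b_ b c_ (beta f) A' 1) A /\
    forall h : R -> fullshift -> R,
      (forall t : R, 0 < t -> normalized_eigenfunction t f (h t)) ->
      exists V : fullshift -> R,
        (forall x : fullshift, t^-1 * ln (h t x) @[t --> +oo] --> V x) /\
        V zeros = 0 /\
        V ones = b - d - beta f + max_term d_ d a_ (beta f) A 1 /\
        (forall (q : nat) (z : fullshift), (1 <= q)%N ->
          V (prepend (nseq q false ++ [:: true]) z)
          = A - d + max_term d_ d a_ (beta f) A q) /\
        (forall (q : nat) (z : fullshift), (1 <= q)%N ->
          V (prepend (nseq q true ++ [:: false]) z)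
          = - d - beta f + A + max_term d_ d a_ (beta f) A 1
            + max_term b_ b c_ (beta f) A q).
Proof.
have /walters_class_sym sym := walters_summable_class hf.
set va := fun s => _ in sym; set vb := fun s => _ in sym.
set la := fun s => _ in sym; set lb := fun s => _ in sym.
have la_beta s : la s = beta f by rewrite /la; case: s.
have va_summable s : cvgn (fun N => \sum_(2 <= n < N) (va s n - beta f)).
  rewrite /va; case: s; first by rewrite -hc; exact: walters_summable_c hf.
  by rewrite -ha; exact: walters_summable_a hf.
have W_lt j k : block_weight va vb (beta f) false 1 j
    + block_weight va vb (beta f) true 1 k < 2 * beta f.
  exact: alternating_orbit_lt sym j k hmax.
have W_cvg s := @block_weight_cvg _ _ _ _ _ _ _ sym va_summable s 1 isT.
have [A A0 AE] := sup_max_balance_ex (W_cvg false) (W_cvg true) W_lt.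
exists A; split.
  (* The equation written with [sup_max] is convertible with the one written with [max_term]. *)
  split=> [|A' [A'0 A'E]]; first by split=> //; rewrite -AE.
  by apply: (sup_max_balance_unique (W_cvg false) (W_cvg true) W_lt) => //; exact/esym.
(* [V] is the pointwise [lim]. The four convergences give its values and, as every point is constant
   or a block by [fullshift_cases], its existence everywhere. *)
move=> h hh; pose V x := lim (t^-1 * ln (h t x) @[t --> +oo]).
have V0 := zeros_cvg hh.
have V1 := ones_cvg sym la_beta va_summable W_lt A0 AE hh.
have Vf q z (q1 : (1 <= q)%N) :=
  block_false_cvg sym la_beta va_summable W_lt A0 AE hh z q1.
have Vt q z (q1 : (1 <= q)%N) :=
  block_true_cvg sym la_beta va_summable W_lt A0 AE hh z q1.
exists V; split; last first.
  split; first exact: cvg_lim V0.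
  split; first exact: cvg_lim V1.
  by split=> q z q1; [exact: cvg_lim (Vf q z q1)|exact: cvg_lim (Vt q z q1)].
move=> x; apply/cvg_ex.
case: (fullshift_cases x) => [[[] ->]|[[] [q [z [q1 ->]]]]]; eexists.
- exact: V1.
- exact: V0.
- exact: Vt.
- exact: Vf.
Qed.
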